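(* Let $G$ be a finite simple graph of tree-width $3$. Then $\mathrm{ch}'(G) \le \Delta(G)+1$, where $\Delta(G)$ is the maximum degree of $G$.
   Context: Given a list assignment $L$ assigning to each edge $e$ of $G$ a set $L(e)\subset\mathbb{N}$, an $L$-edge-colouring is a map $\mathcal{C}$ on $E(G)$ with $\mathcal{C}(e)\in L(e)$ for all $e$ and with adjacent edges (edges sharing an endpoint) receiving different colours. $G$ is $k$-edge-choosable if an $L$-edge-colouring exists for every list assignment $L$ with $|L(e)|\ge k$ for all edges $e$. The list chromatic index $\mathrm{ch}'(G)$ is the smallest $k$ such that $G$ is $k$-edge-choosable. Tree-width is defined via tree decompositions in the usual way: a tree decomposition of width $k$ has all bags of size at most $k+1$. *)

(* Defs.v *)
From mathcomp Require Import all_boot.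
Set Implicit Arguments. Unset Strict Implicit. Unset Printing Implicit Defensive.

Definition simple_graph (T : finType) (adj : rel T) : Prop :=
  symmetric adj /\ irreflexive adj.

Definition edges (T : finType) (adj : rel T) : {set {set T}} :=
  [set [set xy.1; xy.2] | xy : T * T & adj xy.1 xy.2].

Definition degree (T : finType) (adj : rel T) (v : T) : nat :=
  #|[set w | adj v w]|.
Definition max_degree (T : finType) (adj : rel T) : nat :=
  \max_(v : T) degree adj v.

(* |L(e)| >= k for an arbitrary (possibly infinite) subset L(e) of nat. *)
Definition card_at_least (A : pred nat) (k : nat) : Prop :=
  exists s : seq nat, [/\ uniq s, k <= size s & all A s].

Definition L_edge_colouring (T : finType) (adj : rel T)
    (L : {set T} -> pred nat) (c : {set T} -> nat) : Prop :=
  (forall f, f \in edges adj -> L f (c f)) /\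
  (forall f g, f \in edges adj -> g \in edges adj -> f != g ->
     f :&: g != set0 -> c f != c g).

Definition edge_choosable (T : finType) (adj : rel T) (k : nat) : Prop :=
  forall L : {set T} -> pred nat,
    (forall f, f \in edges adj -> card_at_least (L f) k) ->
    exists c : {set T} -> nat, L_edge_colouring adj L c.

Definition list_chromatic_index_le (T : finType) (adj : rel T) (m : nat) : Prop :=
  exists k, k <= m /\ edge_choosable adj k.

Definition acyclic (I : finType) (t : rel I) : Prop :=
  forall (x : I) (p : seq I), uniq (x :: p) -> 2 <= size p -> ~~ cycle t (x :: p).

Definition is_tree (I : finType) (t : rel I) : Prop :=
  [/\ symmetric t, irreflexive t, (forall i j, connect t i j) & acyclic t].

Definition tree_decomposition (T : finType) (adj : rel T)
    (I : finType) (t : rel I) (B : I -> {set T}) : Prop :=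
  [/\ is_tree t,
      (forall v : T, exists i, v \in B i),
      (forall x y : T, adj x y -> exists i, (x \in B i) && (y \in B i)) &
      (forall (v : T) (i j : I), v \in B i -> v \in B j ->
         connect [rel a b | [&& t a b, v \in B a & v \in B b]] i j)].

Definition has_tree_decomposition_of_width_le (T : finType) (adj : rel T) (w : nat) : Prop :=
  exists (I : finType) (t : rel I) (B : I -> {set T}),
    tree_decomposition adj t B /\ forall i, #|B i| <= w.+1.

Definition treewidth_eq (T : finType) (adj : rel T) (w : nat) : Prop :=
  has_tree_decomposition_of_width_le adj w /\
  forall w', w' < w -> ~ has_tree_decomposition_of_width_le adj w'.

(* Main.v *)
Require Import Defs.
From mathcomp Require Import all_boot.
From mathcomp Require Import zify.
From Stdlib Require Import Classical_Prop.
Set Implicit Arguments. Unset Strict Implicit. Unset Printing Implicit Defensive.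

(* Let D be the maximum degree and suppose that G is an edge-minimal
   counterexample, with lists of size D+1.  Colouring everything outside a set F
   of edges leaves residual lists on F, so F may not be colourable from lists
   whose sizes are determined by the degrees in G and in F.  Hence every edge
   has degree sum at least D+3, no even cycle consists of edges of degree sum
   D+3, and no K_{3,4} has its three-element side made of vertices of degree 4;
   bipartite pieces are coloured by Galvin's method, i.e. by stable matchings
   for suitable preference orders.  If D <= 3, then G is cubic, and the first
   vertex of a maximal path yields a forbidden even cycle.  Otherwise call a
   vertex big when twice its degree exceeds D+2; every edge has a big end.
   Eliminating the vertices of G along a width-3 tree decomposition, let v be
   the first big vertex: all but at most three of its neighbours are small, have degree
   3 or 4, and are adjacent only to v and those (at most three) vertices W that
   share the elimination bag of v.  Few small neighbours are possible, and
   counting degrees at v leaves one configuration with D = 4 and two with D = 6,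
   in which v is adjacent to all of W; these are coloured by choosing carefully
   the colours of the edges from v to its small neighbours and applying
   Galvin's method to the rest. *)

(** * Elimination orders from tree decompositions *)

(** A path with distinct vertices can be extended at its front only finitely often; growth happens
    at the first vertex, so that end is the maximal one. *)
Lemma maximal_path (I : finType) (e : rel I) (x0 : I) :
  exists x p, [/\ path e x p, uniq (x :: p), last x p = x0 &
                  forall y, e y x -> y \in x :: p].
Proof.
suff gen n x p : #|I| <= n + size p -> path e x p -> uniq (x :: p) ->
    exists x' p', [/\ path e x' p', uniq (x' :: p'), last x' p' = last x p &
                      forall y, e y x' -> y \in x' :: p'].
  by apply: (gen #|I| x0 [::]); rewrite ?addn0.
elim: n x p => [|n IH] x p le_n pxp uxp.
  have := leq_trans (max_card (mem (x :: p))) le_n.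
  by rewrite (card_uniqP uxp) ltnn.
have [/existsP[y /andP[eyx yNp]]|/existsPn max] :=
  boolP [exists y, e y x && (y \notin x :: p)].
  have [|||x' [p' H]] := IH y (x :: p).
  - by rewrite /= addnS.
  - by rewrite /= eyx.
  - by rewrite cons_uniq yNp.
  by exists x', p'.
exists x, p; split=> // y eyx.
by have := max y; rewrite eyx negbK.
Qed.

(** On a maximal path inside [J], a neighbour of the first vertex other than the second would lie
    further along the path and close a cycle. *)
Lemma acyclic_leaf (I : finType) (t : rel I) (J : {set I}) :
  symmetric t -> irreflexive t -> acyclic t -> J != set0 ->
  exists2 l, l \in J & exists q, forall j, j \in J -> t l j -> j = q.
Proof.
move=> sym_t irr_t acyc /set0Pn[x0 x0J].
have [x [p [pxp uxp lxp max]]] :=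
  maximal_path [rel a b | [&& t a b, a \in J & b \in J]] x0.
have xJ : x \in J.
  by case: p pxp lxp {uxp max} => [_ /= -> //|y p /= /andP[/and3P[]]].
exists x => //; case: p pxp uxp lxp max => [|y p] pxp uxp _ max.
  exists x => j jJ txj; have := max j; rewrite /= sym_t txj jJ xJ inE.
  by move/(_ isT)/eqP.
exists y => j jJ txj; apply/eqP/contraT => jNy.
have := max j; rewrite /= sym_t txj jJ xJ => /(_ isT).
rewrite !inE (negPf jNy) => /orP[/eqP ejx|/= jp]; first by rewrite ejx irr_t in txj.
case/splitPr: jp => p1 p2 in pxp uxp max *.
have uniq_xpj : uniq [:: x, y & rcons p1 j].
  by move: uxp; rewrite -cat_rcons -!cat_cons cat_uniq => /andP[].
have := acyc x (y :: rcons p1 j) uniq_xpj; rewrite /= size_rcons => /(_ isT).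
rewrite rcons_path last_rcons (sym_t j) txj andbT => /negP[].
move: pxp; rewrite /= -cat_rcons cat_path => /and3P[/and3P[-> _ _] pyp _] /=.
by apply: sub_path pyp => a b /and3P[].
Qed.

(** Leaf bags are removed one by one. Vertices found in no other remaining bag are eliminated first,
    with the leaf bag as their [C u]. *)
Lemma elimination_order (T I : finType) (t : rel I) (B : I -> {set T}) (k : nat) :
  symmetric t -> irreflexive t -> acyclic t ->
  (forall (v : T) (i j : I), v \in B i -> v \in B j ->
     connect [rel a b | [&& t a b, v \in B a & v \in B b]] i j) ->
  (forall i, #|B i| <= k) ->
  exists (o : T -> nat) (C : T -> {set T}),
    [/\ forall u, #|C u| <= k,
        forall u v w, v \in C u -> w \in C u -> exists i, (v \in B i) && (w \in B i) &
        forall u v i, u \in B i -> v \in B i -> o u <= o v -> v \in C u].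
Proof.
move=> sym_t irr_t acyc con_B card_B.
pose tJ (J : {set I}) v :=
  [rel a b | [&& t a b, v \in B a, v \in B b, a \in J & b \in J]].
suff gen n (J : {set I}) : #|J| <= n ->
    (forall v i j, i \in J -> j \in J -> v \in B i -> v \in B j ->
       connect (tJ J v) i j) ->
    exists (o : T -> nat) (C : T -> {set T}),
    [/\ forall u, #|C u| <= k,
        forall u v w, v \in C u -> w \in C u -> exists i, (v \in B i) && (w \in B i) &
        forall u v i, i \in J -> u \in B i -> v \in B i -> o u <= o v -> v \in C u].
  have [v i j _ _ vi vj|o [C [cardC clC oC]]] := gen _ setT (leqnn _).
    apply: connect_sub (con_B v i j vi vj) => a b /= /and3P[tab va vb].
    by apply: connect1; rewrite /= tab va vb !inE.
  by exists o, C; split=> // u v i; apply: oC; rewrite inE.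
elim: n J => [|n IH] J cardJ conJ.
  exists (fun=> 0), (fun=> set0); split=> [u|u v w|u v i]; rewrite ?cards0 ?inE //.
  by move: cardJ; rewrite leqn0 cards_eq0 => /eqP->; rewrite inE.
have [->|J0] := eqVneq J set0.
  by exists (fun=> 0), (fun=> set0); split=> [u|u v w|u v i]; rewrite ?cards0 ?inE.
have [l lJ [q leaf]] := acyclic_leaf sym_t irr_t acyc J0.
have [||o [C [cardC clC oC]]] := IH (J :\ l).
- by move: cardJ; rewrite (cardsD1 l) lJ.
- move=> v i j; rewrite !inE => /andP[il iJ] /andP[jl jJ] vi vj.
  have /connectP[p pip ej] := conJ v i j iJ jJ vi vj; rewrite ej in jl *.
  case/shortenP: pip => p' pip uip _ in jl {ej} *.
  (* A duplicate-free path through the leaf would visit its only neighbour [q] both before and after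
     it. *)
  have lNp' : l \notin i :: p'.
    rewrite inE eq_sym (negPf il) /=; apply/negP=> lp'.
    case/splitPr: lp' => p1 p2 in pip uip jl *.
    move: jl; rewrite last_cat; case: p2 => [|c p2] in pip uip *.
      by rewrite /= eqxx.
    move: pip; rewrite cat_path /= => /and3P[_ t1 /andP[t2 _]] _.
    case/and5P: t1 => t1 _ _ aJ _; case/and5P: t2 => t2 _ _ _ cJ.
    have ea : last i p1 = q by apply: leaf; rewrite // sym_t.
    have ec : c = q by apply: leaf.
    move: uip; rewrite -cat_cons cat_uniq => /and3P[_ /hasPn cN _].
    have /negP[] : c \notin i :: p1 by apply: cN; rewrite !inE eqxx orbT.
    by rewrite ec -ea mem_last.
  apply/connectP; exists p' => //.
  elim: p' i pip lNp' {uip jl il iJ vi} => //= b p' IHp i.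
  case/andP=> /and5P[tib vi vb iJ bJ] pb.
  rewrite !inE !negb_or eq_sym => /and3P[il bl lp'].
  by rewrite tib vi vb iJ bJ il eq_sym bl IHp // inE negb_or bl.
(* The vertices of [R] leave together with [l]: they get rank 0, and all other ranks move up by
   one. *)
pose R := [set v in B l | [forall (j | j \in J :\ l), v \notin B j]].
exists (fun u => if u \in R then 0 else (o u).+1),
       (fun u => if u \in R then B l else C u).
split=> [u|u v w|u v i iJ ui vi]; first by case: ifP.
  by case: ifP => _; [move=> vl wl; exists l; rewrite vl wl | apply: clC].
(* The bags containing [x] are connected, and from [l] one can only step to [q]. Pairs in [B l]
   outside [R] are thus handled by induction at [q]. *)
have RN x : x \in B l -> x \notin R -> x \in B q /\ q \in J :\ l.
  move=> xl; rewrite inE xl /= => /forall_inPn[j]; rewrite inE negbK => /andP[/[!inE] jl jJ] xj.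
  have /connectP[[/=|b p] /=] := conJ x l j lJ jJ xl xj.
    by move=> _ ej; rewrite ej eqxx in jl.
  case/andP => /and5P[tlb _ xb _ bJ] _ _; rewrite -(leaf b) //.
  by split=> //; rewrite bJ andbT; apply: contraTneq tlb => ->; rewrite irr_t.
have [uR|uNR] := boolP (u \in R).
  have [<- //|il] := eqVneq i l.
  move: uR; rewrite inE => /andP[_ /forall_inP/(_ i)].
  by rewrite !inE il iJ ui => /(_ isT).
case: ifP => // /negbT vNR; rewrite ltnS => ouv.
have [eil|il] := eqVneq i l; last by apply: oC ui vi ouv; rewrite !inE il.
move: ui vi; rewrite eil => ul vl.
have [uq qJ] := RN u ul uNR; have [vq _] := RN v vl vNR.
exact: oC qJ uq vq ouv.
Qed.

(** * List colouring of bipartite line graphs *)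

Section Galvin.
Variables (J : finType) (X Y : eqType) (x : J -> X) (y : J -> Y).
Variables (p q : J -> nat).
Hypothesis p_inj : forall i j, x i = x j -> p i = p j -> i = j.
Hypothesis q_inj : forall i j, y i = y j -> q i = q j -> i = j.

(** [J] indexes the edges of a bipartite multigraph with ends [x j] and [y j]; [p] and [q] rank the
    edges at these ends, smaller being better. *)
Definition dominates i j :=
  (x i == x j) && (p i < p j) || (y i == y j) && (q i < q j).

(* If the favourite edges of two x-classes share a y-class, the worse of them
   for y can be discarded; otherwise the favourites form the matching. *)
Lemma stable_matching (S : {set J}) :
  exists M : {set J}, [/\ M \subset S,
    forall i j, i \in M -> j \in M -> i != j -> (x i != x j) && (y i != y j) &
    forall j, j \in S -> j \notin M -> exists2 i, i \in M & dominates i j].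
Proof.
have [n] := ubnP #|S|; elim: n S => // n IH S ltSn.
pose best i := (i \in S) && [forall j in S, (x j == x i) ==> (p i <= p j)].
have bestP i j : best i -> j \in S -> x j = x i -> p i <= p j.
  by case/andP=> _ /forall_inP/(_ j) h /h + xji; rewrite xji eqxx.
have [/existsP[i /existsP[j /and5P[bi bj ij yij qij]]]|noclash] :=
  boolP [exists i, exists j, [&& best i, best j, i != j, y i == y j & q i < q j]].
  have [iS jS] : i \in S /\ j \in S by case/andP: bi; case/andP: bj.
  have [|M [sM Mst Mdom]] := IH (S :\ j).
    by move: ltSn; rewrite (cardsD1 j) jS.
  exists M; split=> // [|k kS kM]; first exact: subset_trans sM (subsetDl _ _).
  have [-> {k kS kM}|kj] := eqVneq k j; last by apply: Mdom; rewrite ?inE ?kj.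
  (* If [i] is unmatched, its dominator cannot beat it in the x-class, where [i] is best; so it
     beats [i], and hence [j], in the y-class. *)
  have [iM|iNM] := boolP (i \in M); first by exists i; rewrite // /dominates yij qij orbT.
  have [|k kM] := Mdom i _ iNM; first by rewrite !inE ij.
  have kS : k \in S by have := subsetP sM k kM; rewrite inE => /andP[].
  case/orP=> /andP[/eqP e lt]; first by rewrite ltnNge bestP in lt.
  by exists k; rewrite // /dominates e yij (ltn_trans lt qij) orbT.
exists [set i | best i]; split=> [|i j|j jS].
- by apply/subsetP=> i; rewrite inE => /andP[].
- rewrite !inE => bi bj ij; apply/andP; split; apply: contraNN (ij) => /eqP e.
    apply/eqP; apply: p_inj => //; apply/eqP; rewrite eqn_leq.
    have [iS jS] : i \in S /\ j \in S by case/andP: bi; case/andP: bj.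
    by rewrite !bestP.
  apply/eqP; apply: q_inj => //; apply/eqP; apply: contraNT noclash => qij.
  apply/existsP; have [lt|le] := ltnP (q i) (q j).
    by exists i; apply/existsP; exists j; rewrite bi bj ij e eqxx.
  exists j; apply/existsP; exists i; rewrite bi bj eq_sym ij e eqxx /=.
  by rewrite ltn_neqAle eq_sym qij.
rewrite inE => jNb.
have [|i /andP[iS /eqP xij] imin] :=
  @arg_minnP _ j (fun i => (i \in S) && (x i == x j)) p; first by rewrite jS eqxx.
have bi : best i.
  rewrite /best iS; apply/forall_inP=> k kS; apply/implyP=> /eqP xk.
  by apply: imin; rewrite kS xk xij eqxx.
exists i; rewrite ?inE // /dominates xij eqxx /= ltn_neqAle imin ?jS ?eqxx // andbT.
by apply/orP; left; apply: contraNN jNb => /eqP /(p_inj xij) <-.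
Qed.

(** A colour [a] goes to a stable matching among the edges whose lists contain it. Any other edge
    that loses [a] also loses a dominating edge, so the inequality survives. *)
Lemma kernel_colouring (L : J -> seq nat) (S : {set J}) :
  (forall j, uniq (L j)) ->
  (forall j, j \in S -> #|[set i in S | dominates i j]| < size (L j)) ->
  exists c : J -> nat, (forall j, j \in S -> c j \in L j) /\
    (forall i j, i \in S -> j \in S -> i != j ->
       (x i == x j) || (y i == y j) -> c i != c j).
Proof.
have [n] := ubnP #|S|; elim: n S L => // n IH S L ltSn uL szL.
have [->|/set0Pn[e eS]] := eqVneq S set0.
  by exists (fun=> 0); split=> [j|i j]; rewrite inE.
have : 0 < size (L e) by apply: leq_ltn_trans (szL e eS).
case Le: (L e) => [//|a s] _.
have aLe : a \in L e by rewrite Le mem_head.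
have [M [sM Mst Mdom]] := stable_matching [set j in S | a \in L j].
have MS i : i \in M -> (i \in S) * (a \in L i).
  by move=> /(subsetP sM); rewrite inE => /andP[].
have [m mM] : exists m, m \in M.
  have [|eNM] := boolP (e \in M); first by exists e.
  by have [|i] := Mdom e _ eNM; [rewrite inE eS | exists i].
have [|||c [cL cP]] := IH (S :\: M) (fun j => rem a (L j)).
- apply: leq_trans (_ : #|S| <= n); last by [].
  apply/proper_card/properP; split; first exact: subsetDl.
  by exists m; rewrite ?inE ?mM ?(MS m mM).
- by move=> j; rewrite rem_uniq.
- move=> j; rewrite inE => /andP[jM jS].
  have [ajL|ajN] := boolP (a \in L j); last first.
    rewrite rem_id //; apply: leq_ltn_trans (szL j jS).
    by apply/subset_leq_card/subsetP=> i; rewrite !inE => /andP[/andP[_ ->]].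
  have [|i iM dij] := Mdom j _ jM; first by rewrite inE jS.
  rewrite size_rem // ltn_predRL; apply: leq_ltn_trans (szL j jS).
  apply/proper_card/properP; split.
    by apply/subsetP=> k; rewrite !inE => /andP[/andP[_ ->]].
  by exists i; rewrite !inE ?iM ?(MS i iM).
exists (fun j => if j \in M then a else c j); split=> [j jS|i j iS jS ij conf].
  case: ifPn => [jM|jNM]; first by rewrite (MS j jM).
  by apply: mem_rem (cL j _); rewrite inE jNM.
have cNa k : k \in S -> k \notin M -> c k != a.
  move=> kS kM; have := cL k; rewrite inE kM => /(_ kS).
  by rewrite mem_rem_uniq // inE => /andP[].
case: ifPn => iM; case: ifPn => jM.
- by have := Mst i j iM jM ij; rewrite -negb_or conf.
- by rewrite eq_sym cNa.
- exact: cNa.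
- by apply: cP; rewrite ?inE ?iM ?jM.
Qed.

(** Since ranks are injective within each class, at most [p j + q j] edges dominate [j]. *)
Lemma galvin (L : J -> seq nat) :
  (forall j, uniq (L j)) -> (forall j, p j + q j < size (L j)) ->
  exists c : J -> nat, (forall j, c j \in L j) /\
    (forall i j, i != j -> (x i == x j) || (y i == y j) -> c i != c j).
Proof.
move=> uL szL; have [//|j _|c [cL cP]] := @kernel_colouring L setT.
  apply: leq_ltn_trans (szL j).
  have cardle (K : {set J}) (f : J -> nat) m : {in K &, injective f} ->
      (forall k, k \in K -> f k < m) -> #|K| <= m.
    move=> fi fm; rewrite cardE -(size_map f) -(size_iota 0 m).
    apply: uniq_leq_size.
      by rewrite map_inj_in_uniq ?enum_uniq // => a b; rewrite !mem_enum; apply: fi.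
    by move=> k /mapP[a]; rewrite mem_enum mem_iota => /fm h ->.
  apply: leq_trans (_ : #|[set i | (x i == x j) && (p i < p j)]| +
                        #|[set i | (y i == y j) && (q i < q j)]| <= _).
    apply: leq_trans (leq_card_setU _ _).
    by apply/subset_leq_card/subsetP=> i; rewrite !inE.
  apply: leq_add.
    apply: (cardle _ p) => [a b|a]; rewrite !inE; last by case/andP.
    by move=> /andP[/eqP xa _] /andP[/eqP xb _]; apply: p_inj; rewrite xa xb.
  apply: (cardle _ q) => [a b|a]; rewrite !inE; last by case/andP.
  by move=> /andP[/eqP xa _] /andP[/eqP xb _]; apply: q_inj; rewrite xa xb.
by exists c; split=> [j|i j]; [apply: cL | apply: cP]; rewrite inE.
Qed.

End Galvin.

(** * Edge-critical graphs *)

Section Residual.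
Variable T : finType.
Implicit Types (E F : {set {set T}}) (L R : {set T} -> seq nat).

Definition nbr E v := [set w | [set v; w] \in E].
Definition deg E v := #|nbr E v|.

Definition colourable E L := exists c : {set T} -> nat,
  (forall f, f \in E -> c f \in L f) /\
  (forall f g, f \in E -> g \in E -> f != g -> f :&: g != set0 -> c f != c g).

Lemma degD E F v : F \subset E -> deg (E :\: F) v + deg F v = deg E v.
Proof.
move=> /subsetP sFE; rewrite /deg -(cardsID (nbr F v) (nbr E v)) addnC; congr (_ + _).
  apply: eq_card => w; rewrite !inE andbC.
  by case: (boolP (_ \in F)) => // /sFE ->.
by apply: eq_card => w; rewrite !inE.
Qed.

Lemma deg_ge F x (s : seq T) :
  uniq s -> (forall w, w \in s -> [set x; w] \in F) -> size s <= deg F x.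
Proof.
move=> us sF; rewrite -(card_uniqP us).
by apply/subset_leq_card/subsetP=> w /sF; rewrite inE.
Qed.

(** An edge of [F] loses at most one colour for each edge outside [F] at either end. Writing the
    bound with sums avoids truncated subtraction. *)
Lemma residual_lists E F L : F \subset E -> (forall e, e \in E -> #|e| = 2) ->
  (forall e, uniq (L e)) -> colourable (E :\: F) L ->
  exists R, [/\ forall e, uniq (R e),
    forall x y, [set x; y] \in F ->
      size (L [set x; y]) + (deg F x + deg F y)
        <= size (R [set x; y]) + (deg E x + deg E y) &
    colourable F R -> colourable E L].
Proof.
move=> sFE E2 uL [c [cL cP]].
pose used e := [set f in E :\: F | f :&: e != set0].
pose R e := [seq a <- L e | a \notin [seq c f | f <- enum (used e)]].
exists R; split=> [e|x y xyF|[d [dR dP]]]; first by rewrite filter_uniq.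
- rewrite -!(degD _ sFE) [X in _ <= _ + X]addnACA [X in _ <= X]addnA leq_add2r.
  have le_used : #|used [set x; y]| <= deg (E :\: F) x + deg (E :\: F) y.
    pose im z := [set [set z; w] | w in nbr (E :\: F) z].
    have im_card z : #|im z| <= deg (E :\: F) z by apply: leq_imset_card.
    apply: leq_trans (leq_add (im_card x) (im_card y)).
    apply: leq_trans (leq_card_setU _ _); apply/subset_leq_card/subsetP=> f.
    rewrite 2!inE => /andP[fEF /set0Pn[z]]; rewrite inE => /andP[zf zxy].
    have [_ fE] := andP fEF.
    have [w fw] : exists w, f = [set z; w].
      have /cards2P[a [b [ab ef]]] : #|f| == 2 by rewrite E2.
      move: zf; rewrite ef !inE => /orP[] /eqP ->; first by exists b.
      by exists a; rewrite setUC.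
    have : f \in im z.
      by apply/imsetP; exists w; rewrite // !inE -fw.
    by move: zxy; rewrite !inE => /orP[] /eqP <- ->; rewrite ?orbT.
  apply: leq_trans (leq_add (leqnn _) le_used).
  rewrite -(count_predC (fun a => a \notin [seq c f | f <- enum (used [set x; y])]) (L _)).
  rewrite -size_filter leq_add2l -size_filter.
  rewrite cardE -(size_map c); apply: uniq_leq_size; first by rewrite filter_uniq.
  by move=> a; rewrite mem_filter /= negbK => /andP[].
exists (fun e => if e \in F then d e else c e).
have dN f g : f \in F -> g \in E :\: F -> f :&: g != set0 -> d f != c g.
  move=> fF gF fg; have := dR f fF; rewrite mem_filter => /andP[+ _].
  apply: contraNneq => ->; apply/mapP; exists g => //.
  by rewrite mem_enum inE gF setIC.
split=> [f fE|f g fE gE fg].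
  case: ifPn => fF; first by have := dR f fF; rewrite mem_filter => /andP[].
  by apply: cL; rewrite inE fF.
case: ifPn => fF; case: ifPn => gF fg0.
- exact: dP.
- by apply: dN; rewrite ?inE ?gF.
- by rewrite eq_sym dN ?inE ?fF // setIC.
- by apply: cP; rewrite ?inE ?fF ?gF.
Qed.

(** Transfers a colouring of indices to edges; if [phi] repeats an edge, the colour of one chosen
    index is used. *)
Lemma colourable_family (K : finType) (S : {set K}) (phi : K -> {set T})
    (d : K -> nat) R :
  (forall k, k \in S -> d k \in R (phi k)) ->
  (forall k l, k \in S -> l \in S -> phi k != phi l ->
     phi k :&: phi l != set0 -> d k != d l) ->
  colourable (phi @: S) R.
Proof.
move=> dR dP.
pose c e := if [pick k in S | phi k == e] is Some k then d k else 0.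
have cE e : e \in phi @: S -> exists k, [/\ k \in S, phi k = e & c e = d k].
  case/imsetP=> k kS ->; rewrite /c; case: pickP => [l /andP[lS /eqP pl]|/(_ k)].
    by exists l.
  by rewrite kS eqxx.
exists c; split=> [f /cE[k [kS <- ->]]|f g /cE[k [kS <- ->]] /cE[l [lS <- ->]]].
  exact: dR.
exact: dP.
Qed.

(* What minimality of a counterexample with lists of size D+1 gives: R collects
   what a colouring of E :\: F leaves of the lists on F. *)
Definition critical E D := [/\ forall e, e \in E -> #|e| = 2,
  forall x, deg E x <= D &
  forall F, F \subset E -> F != set0 ->
    exists R, [/\ forall e, uniq (R e),
    forall x y, [set x; y] \in F ->
      D.+1 + (deg F x + deg F y) <= size (R [set x; y]) + (deg E x + deg E y) &
    ~ colourable F R]].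

End Residual.

(** * Degree sums and even cycles in critical graphs *)

Section Reducible.
Variables (T : finType) (E : {set {set T}}) (D : nat).
Hypothesis critE : critical E D.

Lemma critical_neq x y : [set x; y] \in E -> x != y.
Proof.
by case: critE => E2 _ _ /E2; rewrite cards2; case: (x != y).
Qed.

(** For [F] a single edge, a degree sum of at most D + 2 would leave a residual colour. *)
Lemma critical_edge x y : [set x; y] \in E -> D + 3 <= deg E x + deg E y.
Proof.
move=> xyE; case: critE => _ _ crit.
have [||R [uR szR]] := crit [set [set x; y]]; first by rewrite sub1set.
  by apply/set0Pn; exists [set x; y]; rewrite inE.
have dF z w : [set z; w] = [set x; y] -> 0 < deg [set [set x; y]] z.
  move=> e; apply: (@deg_ge _ _ z [:: w]) => // w'; rewrite inE => /eqP ->.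
  by rewrite e inE.
have := szR x y; rewrite inE eqxx => /(_ isT) sz nc.
rewrite leqNgt; apply/negP => lt; apply: nc.
have /hasP[a aR _] : has predT (R [set x; y]).
  rewrite has_predT.
  by have := dF x y erefl; have := dF y x (setUC _ _); lia.
exists (fun=> a); split=> [f|f g]; rewrite !inE; first by move/eqP->.
by move=> /eqP-> /eqP->; rewrite eqxx.
Qed.

Lemma critical_deg_ge3 x y : [set x; y] \in E -> 3 <= deg E x.
Proof.
by move=> /critical_edge; case: critE => _ /(_ y) leD _; lia.
Qed.

(** The residual lists on the cycle have at least (D + 1) + 4 - (D + 3) = 2 colours, which suffices
    for an even cycle. *)
Lemma critical_even_cycle (s : seq T) :
  uniq s -> ~~ odd (size s) -> 2 < size s ->
  cycle (fun x y => ([set x; y] \in E) && (deg E x + deg E y <= D + 3)) s ->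
  False.
Proof.
move=> us even_s lt2s cyc; case: critE => _ _ crit.
have x0 : T by case: s lt2s {us even_s cyc}.
move: lt2s even_s; case def_n: (size s) => [//|n] lt2 even_n.
pose v (i : 'I_n.+1) := nth x0 s i.
have v_inj : injective v.
  by move=> i j /eqP; rewrite nth_uniq ?def_n // => /eqP/val_inj.
have vs i : v i \in s by rewrite mem_nth ?def_n.
pose phi i := [set v i; v (ordS i)].
have /all_and2[vE tight] i : phi i \in E /\ deg E (v i) + deg E (v (ordS i)) <= D + 3.
  apply/andP; have := next_cycle cyc (vs i).
  rewrite /phi; suff -> : v (ordS i) = next s (v i) by [].
  rewrite next_nth vs /v /=; case: s us def_n {cyc vs phi v_inj} @v => // y s us [def_n].
  rewrite index_uniq //= ?def_n //.
  have := ltn_ord i; rewrite ltnS leq_eqVlt => /orP[/eqP ein|lt_in].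
    by rewrite ein modnn /= nth_default ?def_n.
  by rewrite modn_small //=; apply: set_nth_default; rewrite def_n.
have [||R [uR szR nc]] := crit (phi @: setT).
- by apply/subsetP=> _ /imsetP[i _ ->].
- by apply/set0Pn; exists (phi ord0); apply: imset_f.
have ordS_neq2 (i : 'I_n.+1) : ordS i != ord_pred i.
  apply/eqP=> /(congr1 val) /=; case: i => [[|m] /= lt_m].
    by rewrite !modn_small //; lia.
  rewrite modnDr (modn_small (ltnW lt_m)).
  move: lt_m; rewrite ltnS leq_eqVlt => /orP[/eqP em|lt_m].
    by rewrite em modnn; lia.
  by rewrite modn_small //; lia.
have degF i : 2 <= deg (phi @: setT) (v i).
  apply: (@deg_ge _ _ _ [:: v (ordS i); v (ord_pred i)]).
    by rewrite /= inE (inj_eq v_inj) ordS_neq2.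
  move=> w; rewrite !inE => /orP[] /eqP ->; first exact: imset_f.
  by apply/imsetP; exists (ord_pred i); rewrite // /phi ord_predK setUC.
have oddS (i : 'I_n.+1) : odd (ordS i) = ~~ odd i.
  have := ltn_ord i; rewrite ltnS leq_eqVlt /= => /orP[/eqP ein|lt_in].
    by rewrite ein modnn; move: even_n => /=; case: odd.
  by rewrite modn_small.
(* The two sides are the vertices of even and of odd index. Each edge has rank 1 at one end and 0 at
   the other. *)
have [|||i|c [cR cP]] := @galvin _ _ _
    (fun i : 'I_n.+1 => if odd i then ordS i else i)
    (fun i : 'I_n.+1 => if odd i then i else ordS i)
    (fun i => ~~ odd i) (fun i => odd i) _ _ (fun i => R (phi i)).
- move=> i j + oij; move: oij; case: (odd i); case: (odd j) => // _.
  exact: (can_inj (@ordSK n.+1)).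
- move=> i j + oij; move: oij; case: (odd i); case: (odd j) => // _.
  exact: (can_inj (@ordSK n.+1)).
- by move=> i; apply: uR.
- have := szR (v i) (v (ordS i)) (imset_f _ (in_setT i)).
  have := tight i; rewrite -/(phi i).
  by have := degF i; have := degF (ordS i); case: odd => /=; lia.
apply: nc; apply: (colourable_family (d := c)) => [i _|i j _ _ pij /set0Pn[z]].
  exact: cR.
have ij : i != j by apply: contraNneq pij => ->.
rewrite !inE => /andP[/orP[]/eqP-> /orP[]]; rewrite (inj_eq v_inj) => /eqP e;
  apply: cP => //.
- by rewrite e eqxx in ij.
- by rewrite e oddS; case: odd; rewrite eqxx ?orbT.
- by rewrite -e oddS; case: odd; rewrite eqxx ?orbT.
- by move/(can_inj (@ordSK n.+1)): e ij => ->; rewrite eqxx.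
Qed.

End Reducible.

(** * Bipartite configurations *)

(* Preferences are tabulated by rows in tables [tp] (row, then column) and by
   columns in tables [tq] (column, then row). *)
Definition tab (t : seq (seq nat)) i j := nth 0 (nth [::] t i) j.

Lemma tab_inj t m n : all (fun s => uniq s && (size s == n)) t -> size t = m ->
  forall i : 'I_m, injective (fun j : 'I_n => tab t i j).
Proof.
move=> /allP tP tm i j k /eqP.
have /andP[us /eqP ss] : uniq (nth [::] t i) && (size (nth [::] t i) == n).
  by apply: tP; rewrite mem_nth ?tm.
by rewrite /tab nth_uniq ?ss // => /eqP/val_inj.
Qed.

Lemma setI2_neq0 (T : finType) (x y z t : T) :
  ([set x; y] :&: [set z; t] != set0) = [|| x == z, x == t, y == z | y == t].
Proof.
apply/set0Pn/idP => [[v]|].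
  by rewrite !inE => /andP[/orP[]/eqP-> /orP[->|->]]; rewrite ?orbT.
by case/or4P=> /eqP->; [exists z|exists t|exists z|exists t];
   rewrite !inE eqxx ?orbT.
Qed.

Lemma count_sum (n : nat) (P : pred 'I_n) :
  size [seq b <- enum 'I_n | P b] = \sum_b P b.
Proof.
rewrite size_filter -sum1_count big_mkcond big_enum /=.
by apply: eq_bigr => b _; case: (P b).
Qed.

Section Configurations.
Variables (T : finType) (E : {set {set T}}) (D : nat).
Hypothesis critE : critical E D.

(** The residual lists have at least (D + 1) + (4 + 3) - (4 + D) = 4 colours, and the tables give
    every edge a rank sum of at most 3. *)
Lemma critical_K34 (u : 'I_3 -> T) (b : 'I_4 -> T) :
  injective u -> injective b -> (forall i j, [set u i; b j] \in E) ->
  (forall i, deg E (u i) <= 4) -> False.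
Proof.
move=> u_inj b_inj ubE deg_u; case: (critE) => _ leD crit.
pose phi (k : 'I_3 * 'I_4) := [set u k.1; b k.2].
have [||R [uR szR nc]] := crit (phi @: setT).
- by apply/subsetP=> _ /imsetP[[i j] _ ->]; apply: ubE.
- by apply/set0Pn; exists (phi (ord0, ord0)); apply: imset_f.
have degu i : 4 <= deg (phi @: setT) (u i).
  have := @deg_ge _ (phi @: setT) (u i) (codom b).
  rewrite size_codom card_ord map_inj_uniq ?enum_uniq //; apply=> // _ /codomP[j ->].
  by apply/imsetP; exists (i, j).
have degb j : 3 <= deg (phi @: setT) (b j).
  have := @deg_ge _ (phi @: setT) (b j) (codom u).
  rewrite size_codom card_ord map_inj_uniq ?enum_uniq //; apply=> // _ /codomP[i ->].
  by apply/imsetP; exists (i, j); rewrite // setUC.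
pose tp := [:: [:: 0; 1; 2; 3]; [:: 1; 2; 3; 0]; [:: 2; 3; 0; 1]].
pose tq := [:: [:: 2; 1; 0]; [:: 2; 1; 0]; [:: 1; 0; 2]; [:: 0; 2; 1]].
have [|||[i j]|c [cR cP]] := @galvin ('I_3 * 'I_4)%type _ _ fst snd
    (fun k => tab tp k.1 k.2) (fun k => tab tq k.2 k.1) _ _ (fun k => R (phi k)).
- by move=> [i j] [i' j'] /= -> /tab_inj->.
- by move=> [i j] [i' j'] /= -> /tab_inj->.
- by move=> k; apply: uR.
- have := szR (u i) (b j) (imset_f phi (in_setT (i, j))); rewrite -/(phi (i, j)).
  have := degu i; have := degb j; have := deg_u i; have := leD (b j).
  suff : tab tp i j + tab tq j i <= 3 by rewrite /=; lia.
  by case: i j => [[|[|[|//]]] ?] [[|[|[|[|//]]]] ?].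
apply: nc; apply: (colourable_family (d := c)) => [k _|[i j] [i' j'] _ _ pij]; first exact: cR.
rewrite setI2_neq0 /= => conf; apply: cP.
  by apply: contraNneq pij => ->.
have neq k l : u k == b l = false := negbTE (critical_neq critE (ubE k l)).
by move: conf; rewrite neq [b j == _]eq_sym neq (inj_eq u_inj) (inj_eq b_inj).
Qed.

(* The configuration consists of the edges from r 0 to the other r i, and of the
   edges between r and w selected by S; all edges of E at the r i belong to it.
   The former are given the colours alpha, the latter are left to Galvin's method. *)
Section Apex.
Variables (m n : nat) (r : 'I_m.+1 -> T) (w : 'I_n -> T) (S : 'I_m.+1 -> 'I_n -> bool).
Hypotheses (r_inj : injective r) (w_inj : injective w) (rw : forall a b, r a != w b).
Hypothesis rE : forall i, [set r ord0; r (lift ord0 i)] \in E.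
Hypothesis wE : forall a b, S a b -> [set r a; w b] \in E.
Hypothesis deg_r : forall a, deg E (r a) <= (if a == ord0 then m else 1) + \sum_b S a b.
Hypothesis S0 : exists a b, S a b.

(** All edges coloured by [alpha] meet at the apex [r ord0], but only the [i]-th one reaches
    [r (lift ord0 i)]. *)
Definition forbidden (alpha : 'I_m -> nat) a c :=
  [exists i, (c == alpha i) && ((a == ord0) || (a == lift ord0 i))].

(** By [deg_r] no colour is lost at any [r a]. So the edges between the [r a] keep D + 1 colours,
    and the others lose colours only at their end [w b], which has degree at most D. *)
Lemma apex_lists : exists (A : 'I_m -> seq nat) (L : 'I_m.+1 -> 'I_n -> seq nat),
  [/\ forall i, uniq (A i) && (D < size (A i)),
      forall a b, uniq (L a b),
      forall a b, S a b -> \sum_a S a b < size (L a b) &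
      forall alpha P Q, injective alpha -> (forall i, alpha i \in A i) ->
        (forall a, injective (P a)) -> (forall b, injective (Q b)) ->
        (forall a b, S a b ->
           P a b + Q b a < size [seq c <- L a b | ~~ forbidden alpha a c]) ->
        False].
Proof.
case: (critE) => _ leD crit.
pose phi (k : 'I_m + 'I_m.+1 * 'I_n) :=
  match k with inl i => [set r ord0; r (lift ord0 i)] | inr (a, b) => [set r a; w b] end.
pose K := [set k : 'I_m + 'I_m.+1 * 'I_n | if k is inr (a, b) then S a b else true].
have [||R [uR szR nc]] := crit (phi @: K).
- apply/subsetP=> _ /imsetP[k + ->]; case: k => [i _|[a b]]; first exact: rE.
  by rewrite inE; apply: wE.
- by have [a [b Sab]] := S0; apply/set0Pn; exists (phi (inr (a, b))); rewrite imset_f ?inE.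
have rF i : [set r ord0; r (lift ord0 i)] \in phi @: K.
  by apply/imsetP; exists (inl i); rewrite // inE.
have wF a b : S a b -> [set r a; w b] \in phi @: K.
  by move=> Sab; apply/imsetP; exists (inr (a, b)); rewrite // inE.
have degFw b : \sum_a S a b <= deg (phi @: K) (w b).
  rewrite -(count_sum (S^~ b)) -(size_map r); apply: deg_ge.
    by rewrite map_inj_uniq // filter_uniq ?enum_uniq.
  by move=> _ /mapP[a + ->]; rewrite mem_filter setUC => /andP[/wF].
have degFr a : deg E (r a) <= deg (phi @: K) (r a).
  apply: leq_trans (deg_r a) _.
  pose s0 := if a == ord0 then [seq r (lift ord0 i) | i <- enum 'I_m] else [:: r ord0].
  rewrite -(count_sum (S a)) -(size_map w).
  have -> : (if a == ord0 then m else 1) = size s0.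
    by rewrite /s0; case: ifP; rewrite // size_map size_enum_ord.
  rewrite -size_cat; apply: deg_ge => [|x].
    rewrite cat_uniq (map_inj_uniq w_inj) filter_uniq ?enum_uniq // andbT; apply/andP; split.
      rewrite /s0; case: ifP => // _; rewrite map_inj_uniq ?enum_uniq //.
      by move=> i j /r_inj /lift_inj.
    apply/hasPn=> _ /mapP[b _ ->]; rewrite /s0; case: ifP => _.
      by apply/mapP=> -[i _ /eqP]; rewrite eq_sym (negPf (rw _ _)).
    by rewrite inE eq_sym rw.
  rewrite mem_cat => /orP[|/mapP[b + ->]]; last first.
    by rewrite mem_filter => /andP[/wF].
  rewrite /s0; case: eqP => [->|/eqP a0]; first by case/mapP=> i _ ->.
  have := neq_lift; case: (unliftP ord0 a) a0 => [i ->|->]; last by rewrite eqxx.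
  by rewrite inE => _ _ /eqP->; rewrite setUC.
exists (fun i => R [set r ord0; r (lift ord0 i)]), (fun a b => R [set r a; w b]).
split=> [i|a b|a b Sab|alpha P Q alpha_inj alphaA P_inj Q_inj PQ].
- rewrite uR /=; have := szR _ _ (rF i).
  by have := degFr ord0; have := degFr (lift ord0 i); lia.
- exact: uR.
- have := szR _ _ (wF a b Sab).
  by have := degFr a; have := degFw b; have := leD (w b); lia.
apply: nc.
(* A pair outside S is ranked like an edge but gets a dummy list. *)
have [|||[a b]|c [cR cP]] := @galvin ('I_m.+1 * 'I_n)%type _ _ fst snd
    (fun k => P k.1 k.2) (fun k => Q k.2 k.1) _ _
    (fun k => if S k.1 k.2
       then [seq c <- R [set r k.1; w k.2] | ~~ forbidden alpha k.1 c]
       else iota 0 (P k.1 k.2 + Q k.2 k.1).+1).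
- by move=> [a b] [a' b'] /= -> /P_inj->.
- by move=> [a b] [a' b'] /= -> /Q_inj->.
- by move=> k; case: ifP => _; rewrite ?iota_uniq // filter_uniq ?uR.
- by rewrite /=; case: ifP => [/PQ //|_]; rewrite /= size_iota.
have cS a b : S a b -> (c (a, b) \in R [set r a; w b]) && ~~ forbidden alpha a (c (a, b)).
  by move=> Sab; have := cR (a, b); rewrite /= Sab mem_filter andbC.
have r0 i : (r (lift ord0 i) == r ord0) = false.
  by rewrite (inj_eq r_inj) eq_sym (negPf (neq_lift _ _)).
have neq a b : (r a == w b) = false := negbTE (rw a b).
have mixed i a b : S a b ->
    [set r ord0; r (lift ord0 i)] :&: [set r a; w b] != set0 -> alpha i != c (a, b).
  move=> Sab; rewrite setI2_neq0 !neq /= !(inj_eq r_inj) orbF => conf.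
  have /andP[_ /existsPn/(_ i)] := cS a b Sab.
  by rewrite negb_and ![_ == a]eq_sym in conf *; rewrite conf orbF eq_sym.
apply: (colourable_family
  (d := fun k => match k with inl i => alpha i | inr ab => c ab end)).
  by move=> [i|[a b]]; rewrite inE => // /cS/andP[].
move=> [i|[a b]] [j|[a' b']]; rewrite !inE /= => Sk Sl pkl.
- move=> _; apply: contraNneq pkl => /alpha_inj -> //.
- exact: mixed.
- by rewrite setIC => /mixed ne; rewrite eq_sym ne.
rewrite setI2_neq0 !neq [w b == r _]eq_sym neq !(inj_eq r_inj) (inj_eq w_inj) => conf.
by apply: cP => //; apply: contraNneq pkl => -[-> ->].
Qed.

End Apex.
End Configurations.

(** * Configurations with maximum degree 4 and 6 *)

Lemma count_mem_le (A M : seq nat) : uniq A -> count (mem M) A <= size M.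
Proof.
move=> uA; rewrite -size_filter; apply: uniq_leq_size; first exact: filter_uniq.
by move=> a; rewrite mem_filter => /andP[].
Qed.

(** Double counting: otherwise each colour of [A] would lie in at least [k.+1] of the lists [Ms]. *)
Lemma rare_colour (A : seq nat) (Ms : seq (seq nat)) k :
  uniq A -> sumn (map size Ms) < k.+1 * size A ->
  exists2 a, a \in A & count (fun M => a \in M) Ms <= k.
Proof.
move=> uA lt; apply/hasP; apply: contraLR lt => /hasPn big; rewrite -leqNgt.
apply: (@leq_trans (\sum_(a <- A) count (fun M => a \in M) Ms)).
  rewrite -sum1_size big_distrr /= big_seq [leqRHS]big_seq.
  by apply: leq_sum => a aA; rewrite muln1 ltnNge big.
elim: Ms {big} => [|M Ms IH] /=; first by rewrite big1.
rewrite big_split leq_add //; apply: leq_trans (count_mem_le M uA).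
by rewrite -sum1_count [leqRHS]big_mkcond; apply: leq_sum => a _; rewrite /=; case: (a \in M).
Qed.

Lemma nth_ord_inj (T : eqType) (x0 : T) (s : seq T) n :
  uniq s -> size s = n -> injective (fun i : 'I_n => nth x0 s i).
Proof. by move=> us ss i j /eqP; rewrite nth_uniq ?ss // => /eqP/val_inj. Qed.

(** Each [alpha i] removes at most one colour, and one outside the first [k] colours costs nothing
    in this count. *)
Lemma size_take_forbidden0 m (alpha : 'I_m -> nat) (L : seq nat) k : uniq L ->
  size (take k L) <= size [seq c <- L | ~~ forbidden alpha ord0 c]
                     + \sum_i (alpha i \in take k L).
Proof.
move=> uL.
have -> : size (take k L) = count (fun c => ~~ forbidden alpha ord0 c) (take k L)
                          + count (forbidden alpha ord0) (take k L).
  by rewrite addnC count_predC.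
apply: leq_add; first by rewrite size_filter -{2}(cat_take_drop k L) count_cat leq_addr.
have utL : uniq (take k L) by apply: take_uniq.
under eq_bigr do rewrite -(count_uniq_mem _ utL) -sum1_count big_mkcond.
rewrite exchange_big /= -sum1_count big_mkcond; apply: leq_sum => c _.
case: ifP => // /existsP[i /andP[/eqP-> _]].
by rewrite (bigD1 i) //= eqxx.
Qed.

(** Away from the apex only one precoloured edge interferes. *)
Lemma size_forbidden_lift m (alpha : 'I_m -> nat) (L : seq nat) i : uniq L ->
  size L <= (size [seq c <- L | ~~ forbidden alpha (lift ord0 i) c]).+1.
Proof.
move=> uL; rewrite size_filter -(count_predC (forbidden alpha (lift ord0 i))).
rewrite -[leqRHS]add1n leq_add2r.
apply: (leq_trans _ (leq_b1 (alpha i \in L))); rewrite -(count_uniq_mem _ uL).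
apply: sub_count => c /existsP[j /andP[/eqP-> /orP[/eqP/(congr1 val) //|/eqP/lift_inj->]]].
by rewrite /= eqxx.
Qed.

Definition table m n (t : seq (seq nat)) :=
  (size t == m) && all (fun s => uniq s && (size s == n)) t.

(** [x b] records whether the chosen colour hits the list of the [b]-th edge at the apex. The tables
    leave one unit of slack at the edge that is hit. *)
Lemma tables_D4 (x : nat -> bool) : x 0 + x 1 + x 2 <= 1 ->
  exists tp tq, [/\ table 2 3 tp, table 3 2 tq,
    forall b, b < 3 -> tab tp 0 b + tab tq b 0 + x b < nth 0 [:: 3; 3; 2] b &
    forall b, b < 2 -> tab tp 1 b + tab tq b 1 < 2].
Proof.
move=> H; case x0: (x 0).
  exists [:: [:: 0; 2; 1]; [:: 1; 0; 2]], [:: [:: 1; 0]; [:: 0; 1]; [:: 0; 1]].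
  by split=> // -[|[|[|]]] //; rewrite ?x0; move: H; rewrite x0; case: (x 1); case: (x 2).
case x1: (x 1).
  exists [:: [:: 2; 0; 1]; [:: 0; 1; 2]], [:: [:: 0; 1]; [:: 1; 0]; [:: 0; 1]].
  by split=> // -[|[|[|]]] //; rewrite ?x0 ?x1; move: H; rewrite x0 x1; case: (x 2).
exists [:: [:: 1; 2; 0]; [:: 1; 0; 2]], [:: [:: 1; 0]; [:: 0; 1]; [:: 0; 1]].
by split=> // -[|[|[|]]] //; rewrite ?x0 ?x1; case: (x 2).
Qed.

(* The rows [u1], [u2] complete the [v]-row [rho] of [tq] to a Latin square,
   and [tp], [tq] add up to 2 on them. *)
Definition latin_tables (pi rho : seq nat) :=
  ([:: pi; [seq 2 - (c + 1) %% 3 | c <- rho]; [seq 2 - (c + 2) %% 3 | c <- rho]],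
   [seq [:: c; (c + 1) %% 3; (c + 2) %% 3] | c <- rho]).

(** [x] and [y] record the hits of the two chosen colours on lists of length 4; seven candidate
    pairs of tables cover all hit patterns. *)
Lemma tables_D6 (x y : nat -> bool) : x 0 + x 1 + x 2 <= 1 -> y 0 + y 1 + y 2 <= 2 ->
  exists tp tq, [/\ table 3 3 tp, table 3 3 tq,
    forall b, b < 3 -> tab tp 0 b + tab tq b 0 + (x b + y b) < 4 &
    forall a b, a < 2 -> b < 3 -> tab tp a.+1 b + tab tq b a.+1 < 3].
Proof.
pose ok l t := [&& table 3 3 t.1, table 3 3 t.2,
  all (fun b => tab t.1 0 b + tab t.2 b 0 + nth 0 l b < 4) (iota 0 3) &
  all (fun b => all (fun a => tab t.1 a.+1 b + tab t.2 b a.+1 < 3) (iota 0 2)) (iota 0 3)].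
suff search (x0 x1 x2 y0 y1 y2 : bool) :
    x0 + x1 + x2 <= 1 -> y0 + y1 + y2 <= 2 ->
    has (ok [:: x0 + y0; x1 + y1; x2 + y2])
      [:: latin_tables [:: 0; 1; 2] [:: 2; 1; 0];
          latin_tables [:: 1; 0; 2] [:: 0; 2; 1]; latin_tables [:: 1; 2; 0] [:: 0; 1; 2];
          latin_tables [:: 0; 1; 2] [:: 2; 0; 1]; latin_tables [:: 0; 2; 1] [:: 2; 1; 0];
          latin_tables [:: 2; 1; 0] [:: 1; 0; 2]; latin_tables [:: 2; 0; 1] [:: 1; 2; 0]].
  move=> hx hy; have /hasP[t _ /and4P[tp tq /allP row0 /allP rows]] := search _ _ _ _ _ _ hx hy.
  exists t.1, t.2; split=> // [b b3|a b a2 b3].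
    have : b \in iota 0 3 by rewrite mem_iota.
    by move=> /row0; case: b b3 => [|[|[|]]].
  have /rows/allP -> // : b \in iota 0 3 by rewrite mem_iota.
  by rewrite mem_iota.
by case: x0; case: x1; case: x2; case: y0; case: y1; case: y2.
Qed.

Section ApexConfigurations.
Variables (T : finType) (E : {set {set T}}) (D : nat).
Hypothesis critE : critical E D.

(** Merges [apex_lists] with the two loss estimates: at [v] the lists are cut to [k b] colours,
    elsewhere one colour is deducted. *)
Lemma apex_seq (m n : nat) (v : T) (us ws : seq T) (S : 'I_m.+1 -> 'I_n -> bool) :
  size us = m -> size ws = n -> uniq (v :: us ++ ws) ->
  (forall u, u \in us -> [set v; u] \in E) ->
  (forall a b, S a b -> [set nth v (v :: us) a; nth v ws b] \in E) ->
  (forall a : 'I_m.+1,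
     deg E (nth v (v :: us) a) <= (if a == ord0 then m else 1) + \sum_b S a b) ->
  (exists a b, S a b) ->
  exists (A : 'I_m -> seq nat) (L : 'I_m.+1 -> 'I_n -> seq nat),
  [/\ forall i, uniq (A i) && (D < size (A i)),
      forall a b, S a b -> \sum_a S a b < size (L a b) &
      forall alpha (k : 'I_n -> nat) tp tq,
        injective alpha -> (forall i, alpha i \in A i) ->
        table m.+1 n tp -> table n m.+1 tq ->
        (forall b, S ord0 b -> k b <= size (L ord0 b)) ->
        (forall b, S ord0 b ->
           tab tp 0 b + tab tq b 0 + \sum_i (alpha i \in take (k b) (L ord0 b)) < k b) ->
        (forall i b, S (lift ord0 i) b ->
           (tab tp i.+1 b + tab tq b i.+1).+1 < size (L (lift ord0 i) b)) ->
        False].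
Proof.
move=> sus sws; rewrite -cat_cons cat_uniq => /and3P[uvus /hasPn disj uws] usE wsE deg_r S0.
have [||a b|i|//|//|//|A [L [uA uL szL nc]]] :=
  @apex_lists T E D critE m n (fun a => nth v (v :: us) a) (fun b => nth v ws b) S.
- by apply: nth_ord_inj uvus _; rewrite /= sus.
- exact: nth_ord_inj uws sws.
- apply: contraTneq (disj (nth v ws b) _) => [<-|]; last by rewrite mem_nth ?sws.
  by rewrite negbK mem_nth //= sus.
- by apply: (usE (nth v us i)); rewrite mem_nth ?sus.
exists A, L; split=> // alpha k tp tq alpha_inj alphaA.
move=> /andP[/eqP stp atp] /andP[/eqP stq atq] kL L0 LS.
apply: (nc alpha (fun a b => tab tp a b) (fun b a => tab tq b a)) => //.
- exact: tab_inj.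
- exact: tab_inj.
move=> a b; case: (unliftP ord0 a) => [i|] -> Sab.
  have := size_forbidden_lift alpha i (uL (lift ord0 i) b); have := LS i b Sab.
  by rewrite lift0 => h1 h2; rewrite -ltnS; apply: leq_trans h1 h2.
have := size_take_forbidden0 alpha (k b) (uL ord0 b); have := L0 b Sab.
by rewrite size_takel ?kL //=; lia.
Qed.

Lemma critical_D4 (v u w0 w1 w2 : T) : D = 4 -> uniq [:: v; u; w0; w1; w2] ->
  [/\ [set v; u] \in E, [set v; w0] \in E, [set v; w1] \in E & [set v; w2] \in E] ->
  [set u; w0] \in E -> [set u; w1] \in E ->
  deg E v <= 4 -> deg E u <= 3 -> False.
Proof.
move=> D4 uniqs [vu vw0 vw1 vw2] uw0 uw1 dv du.
pose S (a : 'I_2) (b : 'I_3) := ~~ ((a == 1 :> nat) && (b == 2 :> nat)).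
have [//|//|//|x||||A [L [uA szL nc]]] := @apex_seq 1 3 v [:: u] [:: w0; w1; w2] S.
- by rewrite inE => /eqP->.
- by case=> -[|[|//]] ? [[|[|[|//]]] ?].
- by case=> -[|[|//]] ?; rewrite !big_ord_recl big_ord0 /=.
- by exists ord0, ord0.
(* One more than the number of edges from [v] and [u] to each of [w0], [w1], [w2]. *)
pose k b := nth 0 [:: 3; 3; 2] b.
pose M b := take (k b) (L ord0 (inord b)).
have kL (b : 'I_3) : k b <= size (L ord0 b).
  have /szL : S ord0 b by [].
  by rewrite !big_ord_recl big_ord0 /S /k; case: b => [[|[|[|//]]] ?].
have /andP[uA0 szA0] := uA ord0.
(* The edge [vu] has at least 5 colours and 3 + 3 + 2 < 2 * 5, so some colour hits at most one
   list. *)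
have [|a aA /= le1] := @rare_colour (A ord0) [:: M 0; M 1; M 2] 1 uA0.
  rewrite /= !size_takel ?D4 /k /=; first by rewrite D4 in szA0; lia.
  - by have := kL (inord 2); rewrite inordK.
  - by have := kL (inord 1); rewrite inordK.
  - by have := kL (inord 0); rewrite inordK.
have le1' : (a \in M 0) + (a \in M 1) + (a \in M 2) <= 1.
  by rewrite -addnA -[X in _ + X]addn0 -addnA.
have [tp [tq [tpP tqP tab0 tab1]]] := tables_D4 (x := fun b => a \in M b) le1'.
apply: (nc (fun=> a) (fun b => k b) tp tq) => //.
- by move=> i j _; rewrite !ord1.
- by move=> i; rewrite ord1.
- move=> b _; rewrite big_ord1 /=; have := tab0 b (ltn_ord b).
  by rewrite /M inord_val.
- move=> i; rewrite ord1 => b Sib; have sz := szL _ _ Sib.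
  have b2 : b < 2 by move: Sib; case: b {sz} => [[|[|[|]]] ?].
  apply: leq_trans sz; rewrite ltnS; apply: leq_trans (tab1 b b2) _.
  by rewrite !big_ord_recl big_ord0 /S; case: b b2 {Sib} => [[|[|[|]]] ?].
Qed.

Lemma critical_D6_deg5 (v u0 u1 w0 w1 w2 : T) : D = 6 ->
  uniq [:: v; u0; u1; w0; w1; w2] ->
  (forall x, x \in [:: u0; u1; w0; w1; w2] -> [set v; x] \in E) ->
  (forall u w, u \in [:: u0; u1] -> w \in [:: w0; w1; w2] -> [set u; w] \in E) ->
  deg E v <= 5 -> deg E u0 <= 4 -> deg E u1 <= 4 -> False.
Proof.
move=> D6 uniqs vE uwE dv du0 du1.
pose S (a : 'I_3) (b : 'I_3) := true.
have [//|//|//|x|a b _|||A [L [uA szL nc]]] := @apex_seq 2 3 v [:: u0; u1] [:: w0; w1; w2] S.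
- by move=> xu; apply: vE; rewrite (mem_cat x [:: u0; u1] [:: w0; w1; w2]) xu.
- have wb : nth v [:: w0; w1; w2] b \in [:: w0; w1; w2] by rewrite mem_nth.
  case: a => [[|a] lta] /=; last by apply: uwE => //; rewrite mem_nth.
  by apply: vE; rewrite (mem_cat _ [:: u0; u1] [:: w0; w1; w2]) wb orbT.
- by case=> -[|[|[|//]]] ?; rewrite !big_ord_recl big_ord0 /=.
- by exists ord0, ord0.
have szL4 a b : 4 <= size (L a b).
  by have := szL a b isT; rewrite !big_ord_recl big_ord0.
pose M b := take 4 (L ord0 (inord b)).
have szM b : size (M b) = 4 by rewrite size_takel.
have /andP[uA0 szA0] := uA ord0; have /andP[uA1 szA1] := uA (lift ord0 ord0).
(* Since 3 * 4 < 2 * 7, [a0] can hit at most one list. Without [a0] at least 6 colours remain for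
   [a1], and 3 * 4 < 3 * 6 allows at most two hits. *)
have [|a0 aA0 /= le1] := @rare_colour (A ord0) [:: M 0; M 1; M 2] 1 uA0.
  by rewrite /= !szM; lia.
have [||a1] := @rare_colour (rem a0 (A (lift ord0 ord0))) [:: M 0; M 1; M 2] 2.
- exact: rem_uniq.
- have : size (A (lift ord0 ord0)) <= (size (rem a0 (A (lift ord0 ord0)))).+1.
    by have [a0A|/rem_id->//] := boolP (a0 \in A (lift ord0 ord0)); rewrite size_rem ?leqSpred.
  by rewrite /= !szM; lia.
rewrite mem_rem_uniq // inE => /andP[a10 aA1] /= le2.
have [||tp [tq [tpP tqP tab0 tabS]]] := @tables_D6 (fun b => a0 \in M b) (fun b => a1 \in M b).
- by rewrite -addnA -[X in _ + X]addn0 -addnA.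
- by rewrite -addnA -[X in _ + X]addn0 -addnA.
apply: (nc (fun i => nth 0 [:: a0; a1] i) (fun=> 4) tp tq) => //.
- by apply: nth_ord_inj; rewrite //= inE eq_sym a10.
- case=> -[|[|//]] ? /=; [move: aA0 | move: aA1]; congr (_ \in A _); exact: val_inj.
- move=> b _; rewrite !big_ord_recl big_ord0 addn0 /=; have := tab0 b (ltn_ord b).
  by rewrite /M inord_val.
- move=> i b _; apply: leq_trans (szL4 _ _).
  exact: tabS.
Qed.

Lemma critical_D6_deg6 (v u0 u1 u2 w0 w1 w2 : T) : D = 6 ->
  uniq [:: v; u0; u1; u2; w0; w1; w2] ->
  (forall x, x \in [:: u0; u1; u2; w0; w1; w2] -> [set v; x] \in E) ->
  (forall u w, u \in [:: u0; u1] -> w \in [:: w0; w1; w2] -> [set u; w] \in E) ->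
  [set u2; w0] \in E -> [set u2; w1] \in E ->
  deg E v <= 6 -> deg E u0 <= 4 -> deg E u1 <= 4 -> deg E u2 <= 3 -> False.
Proof.
move=> D6 uniqs vE uwE u2w0 u2w1 dv du0 du1 du2.
pose S (a : 'I_4) (b : 'I_3) := ~~ ((a == 3 :> nat) && (b == 2 :> nat)).
have [//|//|//|x|a b|||A [L [uA szL nc]]] :=
  @apex_seq 3 3 v [:: u0; u1; u2] [:: w0; w1; w2] S.
- by move=> xu; apply: vE; rewrite (mem_cat x [:: u0; u1; u2] [:: w0; w1; w2]) xu.
- have wb : nth v [:: w0; w1; w2] b \in [:: w0; w1; w2] by rewrite mem_nth.
  case: a => [[|[|[|[|//]]]] lta] /=.
  + by move=> _; apply: vE; rewrite (mem_cat _ [:: u0; u1; u2] [:: w0; w1; w2]) wb orbT.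
  + by move=> _; apply: uwE; rewrite // mem_head.
  + by move=> _; apply: uwE; rewrite // !inE eqxx orbT.
  + by case: b {wb} => [[|[|[|//]]] ?].
- by case=> -[|[|[|[|//]]]] ?; rewrite !big_ord_recl big_ord0 /=.
- by exists ord0, ord0.
pose k b := nth 0 [:: 5; 5; 4] b.
have szLk a (b : 'I_3) : S a b -> k b <= size (L a b).
  by move/szL; rewrite !big_ord_recl big_ord0 /S /k; case: b => [[|[|[|//]]] ?].
have pick1 i (s : seq nat) : size s < 7 -> exists2 c, c \in A i & c \notin s.
  move=> s7; have /andP[uAi szAi] := uA i.
  have [|c cA /=] := @rare_colour (A i) [:: s] 0 uAi; first by rewrite /=; lia.
  by rewrite addn0 leqn0 eqb0; exists c.
pose o1 : 'I_3 := lift ord0 ord0; pose o2 : 'I_3 := lift ord0 (lift ord0 ord0).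
(* The edge v w1 is ranked last at v, so its list can afford to lose only two colours. *)
have [|a0 aA0 a0N] := pick1 ord0 (take 5 (L ord0 o1)).
  by rewrite size_take; case: ifP; lia.
have [//|a1 aA1 a1N] := pick1 o1 [:: a0].
have [//|a2 aA2 a2N] := pick1 o2 [:: a0; a1].
apply: (nc (fun i => nth 0 [:: a0; a1; a2] i) (fun b => k b)
  [:: [:: 1; 2; 0]; [:: 0; 2; 1]; [:: 2; 1; 0]; [:: 1; 0; 2]]
  [:: [:: 0; 3; 1; 2]; [:: 0; 1; 2; 3]; [:: 0; 1; 2; 3]]) => //.
- apply: nth_ord_inj => //=; move: a1N a2N; rewrite !inE !negb_or andbT => a10 /andP[a20 a21].
  by rewrite ![a0 == _]eq_sym a10 a20 eq_sym a21.
- case=> -[|[|[|//]]] ? /=; [move: aA0 | move: aA1 | move: aA2];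
    congr (_ \in A _); exact: val_inj.
- by move=> b Sb; apply: szLk.
- move=> b _; rewrite !big_ord_recl big_ord0 addn0 /=.
  case: (eqVneq b o1) => [->|b1].
    by rewrite (negPf a0N); do 2 case: (_ \in _).
  case: b b1 => [[|[|[|//]]] ?] // _; rewrite /tab /=; do 3 case: (_ \in _) => //.
- move=> i b Sib; apply: leq_trans (szLk _ _ Sib).
  by move: Sib; case: i => [[|[|[|//]]] ?]; case: b => [[|[|[|//]]] ?].
Qed.

End ApexConfigurations.

(** * Big vertices and their small neighbours *)

(** [d] is the degree of the big vertex, [a] counts its neighbours in [W], and [n3], [n4] count its
    earlier neighbours of degree 3 and 4. For each pair [n3], [n4] the bounds on [d] are
    contradictory or tight, and tightness forces [a = 3]. *)
Lemma degree_count (D d a n3 n4 : nat) :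
  3 < D -> d <= D -> D + 3 <= 2 * d -> d <= a + (n3 + n4) ->
  a <= 3 -> n3 <= 1 -> n4 <= 2 -> (0 < n3 -> D <= d) -> (0 < n4 -> D <= d.+1 /\ 6 <= D) ->
  a = 3 /\ [\/ [/\ n3 = 1, n4 = 0 & D = 4], [/\ n3 = 0, n4 = 2, D = 6 & d <= 5] |
               [/\ n3 = 1, n4 = 2 & D = 6]].
Proof.
move=> D4 dD big dsum a3; case: n3 dsum => [|[|//]] dsum _; case: n4 dsum => [|[|[|//]]] dsum _ h3 h4.
- by lia.
- by have [] := h4 isT; lia.
- have [] := h4 isT; split; first by lia.
  by apply: Or32; split=> //; lia.
- have := h3 isT; split; first by lia.
  by apply: Or31; split=> //; lia.
- by have := h3 isT; have [] := h4 isT; lia.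
- have := h3 isT; have [] := h4 isT; split; first by lia.
  by apply: Or33; split=> //; lia.
Qed.

Section Main.
Variables (T : finType) (E : {set {set T}}) (D : nat).
Hypothesis critE : critical E D.

(** If D <= 3, every degree sum is at most 2D <= D + 3. The first vertex of a maximal path has three
    neighbours on it, two of them at positions of equal parity, which gives a forbidden even
    cycle. *)
Lemma critical_nonsubcubic : E != set0 -> 3 < D.
Proof.
case: (critE) => E2 leD _ /set0Pn[e0 e0E]; rewrite ltnNge; apply/negP=> D3.
have /cards2P[x0 [y0 [_ e0E']]] : #|e0| == 2 by rewrite E2.
rewrite {}e0E' in e0E.
have [x [p [pxp uxp lxp max]]] := maximal_path [rel x y | [set x; y] \in E] x0.
have deg_x : 3 <= deg E x.
  case: p pxp lxp {uxp max} => [_ /= ->|z p /= /andP[xz _] _].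
    exact (critical_deg_ge3 critE e0E).
  exact (critical_deg_ge3 critE xz).
have nbr_p z : [set x; z] \in E -> z \in p.
  move=> xz; have := max z; rewrite /= setUC => /(_ xz).
  by rewrite inE eq_sym (negPf (critical_neq critE xz)).
have same_parity a b : [set x; a] \in E -> [set x; b] \in E ->
    odd (index a p) = odd (index b p) -> a = b.
  move=> xa xb; wlog lt_ab : a b xa xb / index a p < index b p => [gen|].
    case: (ltngtP (index a p) (index b p)) => [||eq_ab _].
    - exact: gen.
    - by move=> lt /esym par; apply/esym/gen.
    - by rewrite -(nth_index x (nbr_p a xa)) eq_ab nth_index ?nbr_p.
  move=> par; exfalso.
  have : b \in p by apply: nbr_p.
  case/splitPr: (nbr_p a xa) => p1 p2 in pxp uxp par lt_ab *.
  have aNp1 : a \notin p1.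
    by move: uxp; rewrite /= cat_uniq => /and4P[_ _ /hasPn/(_ a)]; rewrite mem_head => ->.
  have ia : index a (p1 ++ a :: p2) = size p1.
    by rewrite index_cat (negPf aNp1) /= eqxx addn0.
  rewrite ia in par lt_ab; rewrite mem_cat => /orP[bp1|].
    by move: lt_ab; rewrite index_cat bp1 ltnNge index_size.
  rewrite inE => /orP[/eqP eba|bp2]; first by rewrite eba ia ltnn in lt_ab.
  case/splitPr: bp2 => p3 p4 in pxp uxp par lt_ab {ia} *.
  have bN : b \notin p1 ++ a :: p3.
    move: uxp; rewrite cons_uniq -cat_cons catA cat_uniq => /and4P[_ _ /hasPn/(_ b)].
    by rewrite mem_head => ->.
  (* [p3] is the stretch strictly between [a] and [b]; the cycle [x], [a], [p3], [b] therefore has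
     even length. *)
  have odd_p3 : odd (size p3).
    move: par; rewrite -cat_cons catA index_cat (negPf bN) /= eqxx addn0 size_cat oddD /=.
    by case: odd; case: odd.
  have tight y z : [set y; z] \in E -> ([set y; z] \in E) && (deg E y + deg E z <= D + 3).
    by move=> ->; rewrite (leq_trans (leq_add (leD y) (leD z))) ?leq_add2l.
  apply: (@critical_even_cycle _ _ _ critE (x :: a :: rcons p3 b)).
  - apply: subseq_uniq uxp; rewrite /= eqxx -(cat_rcons b p3) -cat_cons.
    exact: subseq_trans (prefix_subseq _ _) (suffix_subseq _ _).
  - by rewrite /= size_rcons /= odd_p3.
  - by rewrite /= size_rcons.
  - rewrite /= rcons_path last_rcons tight //= tight ?andbT; last by rewrite setUC.
    move: pxp; rewrite cat_path /= -cat_rcons cat_path => /and4P[_ _ pab _].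
    by apply: sub_path pab => y z; apply: tight.
have [s us [ss sE]] : exists2 s, uniq s & size s = 3 /\ {subset s <= nbr E x}.
  exists (take 3 (enum (nbr E x))); first by rewrite take_uniq ?enum_uniq.
  by split=> [|z /mem_take]; rewrite ?mem_enum // size_takel // -cardE.
case: s us ss sE => [|a [|b [|c []]]] //= us _ sE.
have [xa xb xc] : [/\ [set x; a] \in E, [set x; b] \in E & [set x; c] \in E].
  by split; have := sE _; [move/(_ a)|move/(_ b)|move/(_ c)]; rewrite !inE eqxx ?orbT; apply.
suff : ~~ uniq [:: a; b; c] by rewrite /= us.
rewrite /= !inE; have := same_parity b c xb xc.
have := same_parity a b xa xb; have := same_parity a c xa xc.
case: odd; case: odd; case: odd => h1 h2 h3;
  by do ?[rewrite (h1 erefl) | rewrite (h2 erefl) | rewrite (h3 erefl)]; rewrite eqxx ?orbT ?andbF.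
Qed.

Lemma seq_of_card (A : {set T}) n : #|A| = n ->
  exists s, [/\ uniq s, size s = n & s =i A].
Proof.
move=> cA; exists (enum A); split; rewrite ?enum_uniq -?cardE //.
exact: mem_enum.
Qed.

(** [H x y] stands for [x] and [y] sharing a bag, and [C u] for the elimination bag of [u]. *)
Variables (H : T -> T -> Prop) (o : T -> nat) (C : T -> {set T}).
Hypotheses (H_sym : forall x y, H x y -> H y x) (H_refl : forall x y, H x y -> H x x).
Hypothesis H_edge : forall x y, [set x; y] \in E -> H x y.
Hypothesis card_C : forall u, #|C u| <= 4.
Hypothesis C_clique : forall u v w, v \in C u -> w \in C u -> H v w.
Hypothesis C_later : forall u v, H u v -> o u <= o v -> v \in C u.

(* v is the first big vertex, W the rest of its elimination bag and U the set of
   its neighbours eliminated before it. *)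
Lemma critical_structure : E != set0 ->
  exists (v : T) (W U : {set T}), [/\ #|W| <= 3 /\ v \notin W, D + 3 <= 2 * deg E v,
    nbr E v \subset W :|: U /\ U \subset nbr E v,
    [disjoint W & U] &
    forall u, u \in U -> 2 * deg E u <= D + 2 /\ nbr E u \subset v |: W].
Proof.
case: (critE) => E2 leD _ /set0Pn[e eE].
have /cards2P[x [y [_ e_xy]]] : #|e| == 2 by rewrite E2.
rewrite {}e_xy in eE.
pose big z := D + 3 <= 2 * deg E z.
have [b0 big_b0] : exists b, big b.
  have := critical_edge critE eE; rewrite /big.
  have [le|lt] := leqP (deg E x) (deg E y); first by exists y; lia.
  by exists x; lia.
have [v big_v min_v] := @arg_minnP _ b0 big o big_b0.
have vCv : v \in C v.
  have /card_gt0P[w] : 0 < #|nbr E v| by move: big_v; rewrite /big /deg; lia.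
  by rewrite inE => /H_edge/H_refl/C_later->.
exists v, (C v :\ v), (nbr E v :\: C v); split=> //.
- split; last by rewrite !inE eqxx.
  by have := card_C v; rewrite (cardsD1 v) vCv.
- split; last exact: subsetDl.
  apply/subsetP=> w vw; rewrite !inE; move: vw; rewrite inE => vw.
  rewrite vw andbT; case: (w \in C v); rewrite ?orbT // andbT orbF.
  by rewrite eq_sym (critical_neq critE vw).
- by rewrite -setI_eq0; apply/eqP/setP=> w; rewrite !inE; case: (w \in C v); rewrite ?andbF.
move=> u; rewrite !inE => /andP[uNC vu].
have lt_ov : o u < o v.
  by rewrite ltnNge; apply: contra uNC; apply: C_later (H_edge vu).
have small_u : ~~ big u by apply: contraL lt_ov => /min_v; rewrite -leqNgt.
split; first by move: small_u; rewrite /big; lia.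
(* A neighbour [w] of the small vertex [u] is big, hence not earlier than [v]. So [v] and [w] both
   lie in [C u], share a bag, and [w] lies in [C v]. *)
apply/subsetP=> w; rewrite !inE => uw.
have big_w : big w by have := critical_edge critE uw; move: small_u; rewrite /big; lia.
case: eqP => //= _.
have Huv : H u v by apply: H_sym; apply: H_edge.
have := C_clique (C_later Huv (ltnW lt_ov)) (C_later (H_edge uw) _).
move/(_ (leq_trans (ltnW lt_ov) (min_v w big_w)))/C_later; apply.
exact: min_v.
Qed.

Lemma critical_absurd : E != set0 -> False.
Proof.
move=> E0; have D4 := critical_nonsubcubic E0; case: (critE) => _ leD _.
have [v [W [U [[W3 vW] big_v [NWU UN] disjWU U_small]]]] := critical_structure E0.
have vU u : u \in U -> [set v; u] \in E by move/(subsetP UN); rewrite inE.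
have uvE u : u \in U -> [set u; v] \in E by move/vU; rewrite setUC.
have vNU : v \notin U by apply/negP=> /vU/(critical_neq critE); rewrite eqxx.
have UNW u : u \in U -> u \notin W by move=> uU; rewrite (disjointFl disjWU uU).
have deg_u u : u \in U -> deg E u = #|nbr E u :&: W| + 1.
  move=> uU; have [_ nuW] := U_small u uU.
  rewrite /deg (cardsD1 v) [v \in _]inE uvE // addnC; congr (_ + 1); apply: eq_card => w.
  rewrite !inE andbC; case uw: (_ \in E) => //=.
  have := subsetP nuW w; rewrite !inE uw => /(_ isT).
  by case: (eqVneq w v) => [->|] //=; rewrite (negPf vW).
have deg_u34 u : u \in U -> deg E u = 3 \/ deg E u = 4.
  move=> uU; have := critical_deg_ge3 critE (uvE u uU); have := deg_u u uU.
  by have := subset_leq_card (subsetIr (nbr E u) W); lia.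
have uniq_vuw us ws : uniq us -> uniq ws -> {subset us <= U} -> {subset ws <= W} ->
    uniq (v :: us ++ ws).
  move=> uus uws usU wsW; rewrite /= cat_uniq uus uws mem_cat negb_or !andbT.
  rewrite (contra (usU v) vNU) (contra (wsW v) vW) /=.
  by apply/hasPn=> w /wsW wW; apply/negP=> /usU/UNW; rewrite wW.
have deg_v : deg E v <= #|nbr E v :&: W| + #|U|.
  apply: leq_trans (leq_card_setU _ _); apply/subset_leq_card/subsetP=> w vw.
  by have := subsetP NWU w vw; rewrite !inE; move: vw; rewrite inE => ->.
have le_W := subset_leq_card (subsetIr (nbr E v) W).
pose U3 := [set u in U | deg E u == 3]; pose U4 := [set u in U | deg E u == 4].
have card_U : #|U| = #|U3| + #|U4|.
  rewrite -cardsUI; have -> : U3 :&: U4 = set0.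
    by apply/setP=> u; rewrite !inE; case: eqP => [->|]; rewrite ?andbF.
  rewrite cards0 addn0; apply: eq_card => u; rewrite !inE -andb_orr.
  case uU: (u \in U) => //=.
  by case: (deg_u34 u uU) => ->.
(* Two such vertices each have two neighbours in [W], hence a common one [w]; the cycle [u1], [v],
   [u2], [w] has degree sums at most D + 3. *)
have le_U3 : #|U3| <= 1.
  rewrite leqNgt; apply/negP=> /card_gt1P[u1 [u2 [u1U u2U u12]]].
  move: u1U u2U; rewrite !inE => /andP[u1U /eqP d1] /andP[u2U /eqP d2].
  have [w] : exists w, w \in (nbr E u1 :&: W) :&: (nbr E u2 :&: W).
    apply/card_gt0P; have := cardsUI (nbr E u1 :&: W) (nbr E u2 :&: W).
    have : #|(nbr E u1 :&: W) :|: (nbr E u2 :&: W)| <= #|W|.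
      by apply/subset_leq_card; rewrite -setIUl subsetIr.
    by have := deg_u u1 u1U; have := deg_u u2 u2U; lia.
  rewrite !inE => /andP[/andP[u1w wW] /andP[u2w _]].
  have tight u z : [set u; z] \in E -> deg E u = 3 ->
      ([set u; z] \in E) && (deg E u + deg E z <= D + 3).
    by move=> -> ->; rewrite addnC leq_add2r leD.
  have tightC u z : [set u; z] \in E -> deg E u = 3 ->
      ([set z; u] \in E) && (deg E z + deg E u <= D + 3).
    by move=> uz du; rewrite setUC addnC tight.
  apply: (@critical_even_cycle _ _ _ critE [:: u1; v; u2; w]) => //; last first.
    rewrite /= (tight u1 v) ?(tightC u2 v) ?(tight u2 w) ?(tightC u1 w) //;
    exact: uvE.
  have -> : uniq [:: u1; v; u2; w] = uniq [:: v; u1; u2; w].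
    exact/perm_uniq/permEl/(perm_catCA [:: u1] [:: v] [:: u2; w]).
  apply: (uniq_vuw [:: u1; u2] [:: w]) => [|//|z|z]; rewrite ?/= !inE ?u12 //.
    by move=> /orP[]/eqP->.
  by move=> /eqP->.
have full4 u w : u \in U4 -> w \in W -> [set u; w] \in E.
  rewrite !inE => /andP[uU /eqP du] wW; have := deg_u u uU; rewrite du => cW.
  have /eqP eW : nbr E u :&: W == W.
    by rewrite eqEcard subsetIr /=; lia.
  by move: wW; rewrite -eW !inE => /andP[].
have card_W4 u : u \in U4 -> #|W| = 3.
  rewrite inE => /andP[uU /eqP du]; have := deg_u u uU.
  by have := subset_leq_card (subsetIr (nbr E u) W); lia.
(* A vertex of [U4] is adjacent to [v] and all of [W], so three of them would give a [K_{3,4}]. *)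
have le_U4 : #|U4| <= 2.
  rewrite leqNgt; apply/negP=> lt2.
  pose us := take 3 (enum U4).
  have us3 : size us = 3 by rewrite size_takel // -cardE.
  have usU u : u \in us -> u \in U4 by move/mem_take; rewrite mem_enum.
  have uus : uniq us by rewrite take_uniq ?enum_uniq.
  have u4 : nth v us 0 \in U4 by apply: usU; rewrite mem_nth ?us3.
  have [ws [uws ws3 wsW]] := seq_of_card (card_W4 _ u4).
  apply: (@critical_K34 _ _ _ critE (fun i => nth v us i) (fun j => nth v (v :: ws) j)).
  - exact: nth_ord_inj.
  - apply: nth_ord_inj; rewrite /= ?ws3 //.
    by apply: (uniq_vuw [::] ws) => // w; rewrite wsW.
  - move=> i j; have uiU4 : nth v us i \in U4 by apply: usU; rewrite mem_nth ?us3.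
    have uiU : nth v us i \in U by move: uiU4; rewrite inE => /andP[].
    case: j => [[|j] /= ltj]; first exact: uvE.
    by apply: full4; rewrite // -wsW mem_nth // ws3.
  - move=> i; have : nth v us i \in U4 by apply: usU; rewrite mem_nth ?us3.
    by rewrite inE => /andP[_ /eqP->].
have deg_nbr3 : 0 < #|U3| -> D <= deg E v.
  case/card_gt0P=> u; rewrite inE => /andP[uU /eqP du].
  by have := critical_edge critE (uvE u uU); rewrite du addnC leq_add2l.
(* The bound 6 <= D holds because a vertex of degree 4 is small only if 8 <= D + 2. *)
have deg_nbr4 : 0 < #|U4| -> D <= (deg E v).+1 /\ 6 <= D.
  case/card_gt0P=> u; rewrite inE => /andP[uU /eqP du].
  have := critical_edge critE (uvE u uU); have [+ _] := U_small u uU.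
  by rewrite du; clear; lia.
have vW_E : #|nbr E v :&: W| = 3 -> forall w, w \in W -> [set v; w] \in E.
  move=> c3 w wW; have /eqP eW : nbr E v :&: W == W by rewrite eqEcard subsetIr c3.
  by move: wW; rewrite -eW !inE => /andP[].
have U3P u : u \in U3 -> (u \in U) /\ deg E u = 3 by rewrite inE => /andP[? /eqP].
have U4P u : u \in U4 -> (u \in U) /\ deg E u = 4 by rewrite inE => /andP[? /eqP].
rewrite card_U in deg_v.
have [c3 config] :=
  degree_count D4 (leD v) big_v deg_v (leq_trans le_W W3) le_U3 le_U4 deg_nbr3 deg_nbr4.
have {}vW_E := vW_E c3.
have eW3 : #|W| = 3 by apply/eqP; rewrite eqn_leq W3 -{1}c3.
have pair4 : #|U4| = 2 -> exists u0 u1,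
    [/\ u0 != u1, u0 \in U4, u1 \in U4 & forall u, u \in [:: u0; u1] -> u \in U4].
  move/eqP/cards2P=> [u0 [u1 [u01 ->]]]; exists u0, u1.
  by split=> [||| u]; rewrite ?set21 ?set22 // !inE.
have nbrs3 : #|U3| = 1 -> exists u w0 w1 w2, [/\ u \in U3, [set u; w0] \in E, [set u; w1] \in E,
    uniq [:: w0; w1; w2] & {subset [:: w0; w1; w2] <= W}].
  move/eqP/cards1P=> [u eU3]; have uU3 : u \in U3 by rewrite eU3 set11.
  have [uU du] := U3P u uU3; exists u.
  have cuW : #|nbr E u :&: W| = 2.
    by apply/eqP; rewrite -(eqn_add2r 1) -deg_u // du.
  have /cards2P[w0 [w1 [w01 eW]]] : #|nbr E u :&: W| == 2 by rewrite cuW.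
  have : w0 \in nbr E u :&: W by rewrite eW set21.
  have : w1 \in nbr E u :&: W by rewrite eW set22.
  rewrite !inE => /andP[uw1 w1W] /andP[uw0 w0W].
  have [w2 w2W w2N] : exists2 w2, w2 \in W & w2 \notin [set w0; w1].
    by apply/subsetPn; apply/negP=> /subset_leq_card; rewrite cards2 w01 eW3.
  exists w0, w1, w2; split; rewrite ?uU ?du //; last by move=> w; rewrite !inE => /or3P[]/eqP->.
  by move: w2N; rewrite /= !inE !negb_or w01 andbT ![w2 == _]eq_sym => /andP[-> ->].
case: config => [[n3 n4 eD]|[n3 n4 eD dv]|[n3 n4 eD]].
- have [u [w0 [w1 [w2 [uU3 uw0 uw1 uws wsW]]]]] := nbrs3 n3; have [uU du] := U3P u uU3.
  apply: (critical_D4 critE eD (w2 := w2) _ _ uw0 uw1); rewrite -?eD ?du //.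
    by apply: (uniq_vuw [:: u]) => // z; rewrite inE => /eqP->.
  by split; [apply: vU | apply: vW_E; apply: wsW; rewrite !inE eqxx ?orbT ..].
- have [u0 [u1 [u01 /U4P[u0U d0] /U4P[u1U d1] us4]]] := pair4 n4.
  have [ws [uws ws3 wsW]] := seq_of_card eW3.
  case: ws uws ws3 wsW => [|w0 [|w1 [|w2 []]]] // uws _ wsW.
  have usU u : u \in [:: u0; u1] -> u \in U by case/us4/U4P.
  apply: (critical_D6_deg5 critE eD (v := v) (u0 := u0) (u1 := u1) (w0 := w0) (w1 := w1) (w2 := w2));
    rewrite ?d0 ?d1 //.
  + by apply: (uniq_vuw [:: u0; u1]) => // [|z]; rewrite ?wsW //= inE u01.
  + move=> x; rewrite (mem_cat x [:: u0; u1] [:: w0; w1; w2]) wsW.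
    by case/orP=> [/usU/vU|/vW_E].
  + by move=> u w; rewrite wsW => /us4; apply: full4.
- have [u2 [w0 [w1 [w2 [u2U3 u2w0 u2w1 uws wsW]]]]] := nbrs3 n3.
  have [u2U d2] := U3P u2 u2U3.
  have [u0 [u1 [u01 /U4P[u0U d0] /U4P[u1U d1] us4]]] := pair4 n4.
  have usU u : u \in [:: u0; u1; u2] -> u \in U.
    by rewrite !inE => /or3P[]/eqP->.
  apply: (critical_D6_deg6 critE eD (v := v) (u0 := u0) (u1 := u1) _ _ _ u2w0 u2w1 (w2 := w2));
    rewrite -?eD ?d0 ?d1 ?d2 //.
  + apply: (uniq_vuw [:: u0; u1; u2]) => //=; rewrite !inE negb_or u01 !andbT.
    by apply/andP; split; apply: contra_eqN d2 => /eqP <-; rewrite ?d0 ?d1.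
  + move=> x; rewrite (mem_cat x [:: u0; u1; u2] [:: w0; w1; w2]).
    by case/orP=> [/usU/vU|/wsW/vW_E].
  + by move=> u w /us4 uU4 /wsW; apply: full4.
Qed.

End Main.

(** * From critical graphs to list colourings *)

(** In an induction on the number of edges, a non-colourable [E] is critical: removing a nonempty
    [F] leaves a colourable set, to which [residual_lists] applies. *)
Lemma colourable_of_order (T : finType) (H : T -> T -> Prop) (o : T -> nat)
    (C : T -> {set T}) (D : nat) (L : {set T} -> seq nat) :
  (forall x y, H x y -> H y x) -> (forall x y, H x y -> H x x) ->
  (forall u, #|C u| <= 4) ->
  (forall u v w, v \in C u -> w \in C u -> H v w) ->
  (forall u v, H u v -> o u <= o v -> v \in C u) ->
  (forall e, uniq (L e)) ->
  forall E : {set {set T}}, (forall e, e \in E -> #|e| = 2) ->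
    (forall x, deg E x <= D) -> (forall x y, [set x; y] \in E -> H x y) ->
    (forall e, e \in E -> D < size (L e)) -> colourable E L.
Proof.
move=> Hsym Hrefl cardC clC oC uL E.
have [n] := ubnP #|E|; elim: n E => // n IH E ltEn E2 leD EH szL.
apply: NNPP => ncol.
have critE : critical E D.
  split=> // F sFE F0.
  have [|R [uR szR colR]] := residual_lists sFE E2 uL.
    apply: IH => [|e|x|x y|e].
    - apply: leq_trans (_ : #|E| <= n); last by [].
      apply/proper_card/properP; split; first exact: subsetDl.
      by have /set0Pn[f fF] := F0; exists f; rewrite ?(subsetP sFE) // inE fF.
    - by rewrite inE => /andP[_ /E2].
    - by apply: leq_trans (leD x); rewrite -(degD x sFE) leq_addr.
    - by rewrite inE => /andP[_ /EH].
    - by rewrite inE => /andP[_ /szL].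
  exists R; split=> // [x y xyF|/colR //].
  apply: leq_trans (szR x y xyF); rewrite leq_add2r.
  exact: szL (subsetP sFE _ xyF).
apply: (critical_absurd critE Hsym Hrefl EH cardC clC oC).
apply/negP=> /eqP E0; apply: ncol; rewrite E0.
by exists (fun=> 0); split=> [f|f g]; rewrite inE.
Qed.

Theorem theorem1 (T : finType) (adj : rel T) :
  simple_graph adj -> treewidth_eq adj 3 ->
  list_chromatic_index_le adj (max_degree adj).+1.
Proof.
case=> sym_adj irr_adj [[I [t [B [[tree_t covB edgeB conB] cardB]]]] _].
case: tree_t => sym_t irr_t _ acyc.
exists (max_degree adj).+1; split=> // L szL.
have [o [C [cardC clC oC]]] := elimination_order sym_t irr_t acyc conB cardB.
have edgeE x y : ([set x; y] \in edges adj) = adj x y.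
  apply/imsetP/idP => [[[a b] /=]|xy]; last by exists (x, y); rewrite ?inE.
  rewrite inE /= => ab eq_xy.
  have aNb : a != b by apply: contraTneq ab => ->; rewrite irr_adj.
  have /orP[/eqP ea|/eqP ea] : (a == x) || (a == y) by rewrite -in_set2 eq_xy set21.
    have /orP[/eqP eb|/eqP eb] : (b == x) || (b == y) by rewrite -in_set2 eq_xy set22.
      by rewrite ea eb eqxx in aNb.
    by rewrite -ea -eb.
  have /orP[/eqP eb|/eqP eb] : (b == x) || (b == y) by rewrite -in_set2 eq_xy set22.
    by rewrite -ea -eb sym_adj.
  by rewrite ea eb eqxx in aNb.
have degE x : deg (edges adj) x = degree adj x.
  by apply: eq_card => y; rewrite !inE edgeE.
(* Possibly infinite lists are replaced by finite duplicate-free ones that are still long enough;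
   non-edges get the empty list. *)
have [l lP] : exists l : {set T} -> seq nat, forall f, uniq (l f) /\
    (f \in edges adj -> max_degree adj < size (l f) /\ all (L f) (l f)).
  apply: (fin_all_exists (P := fun f s => uniq s /\
    (f \in edges adj -> max_degree adj < size s /\ all (L f) s))) => f.
  have [fE|_] := boolP (f \in edges adj); last by exists [::].
  by have [s [us ss sL]] := szL f fE; exists s.
have [||||||e|x|x y|e /(proj2 (lP e))[] //|c [cl cP]] := @colourable_of_order T
  (fun x y => exists i, (x \in B i) && (y \in B i)) o C (max_degree adj) l _ _ _ _ _ _ (edges adj).
- by move=> x y [i /andP[xi yi]]; exists i; rewrite xi yi.
- by move=> x y [i /andP[xi _]]; exists i; rewrite xi.
- exact: cardC.
- exact: clC.
- by move=> u v [i /andP[ui vi]]; apply: oC ui vi.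
- by move=> e; have [] := lP e.
- case/imsetP=> -[x y]; rewrite inE /= => xy ->; rewrite cards2.
  by case: eqP xy => // ->; rewrite irr_adj.
- by rewrite degE; apply: leq_bigmax.
- by rewrite edgeE => /edgeB.
exists c; split=> // f fE.
by have [_ /(_ fE)[_ /allP]] := lP f; apply; apply: cl.
Qed.
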